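(* Let polynomials $a_0(\lambda),\dots,a_{d-1}(\lambda)$ in $\lambda=(\lambda_1,\dots,\lambda_n)\in\mathbb{C}^n$ be given, and let $a_k(\lambda)$, $k=d,d+1,\dots$, be produced by a non-stationary polynomial recurrence relation of length $d$, $$a_k(\lambda)=P_k\bigl(a_{k-1}(\lambda),\dots,a_{k-d}(\lambda)\bigr),\qquad k=d,d+1,\dots,$$ where $$P_k(u_1,\dots,u_d)=\sum_{|\alpha|\le d_k}A_{k,\alpha}(\lambda)\,u^\alpha,\qquad A_{k,\alpha}(\lambda)=\sum_{|\beta|\le d_{k,\alpha}}A_{k,\alpha,\beta}\,\lambda^\beta,$$ with complex constants $A_{k,\alpha,\beta}$, and with no restrictions on the degrees and the size of the polynomials $P_k$. Then the Bautin ideal $I$ of the formal series $f_\lambda(z)=\sum_{k=0}^\infty a_k(\lambda)z^k$ is generated by $a_0(\lambda),\dots,a_{d-1}(\lambda)$.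
   Context: Notation: $u=(u_1,\dots,u_d)\in\mathbb{C}^d$; $\alpha=(\alpha_1,\dots,\alpha_d)\in\mathbb{N}^d$ and $\beta=(\beta_1,\dots,\beta_n)\in\mathbb{N}^n$ are multi-indices, $|\alpha|=|\alpha_1|+\dots+|\alpha_d|$, $|\beta|=|\beta_1|+\dots+|\beta_n|$, $u^\alpha=u_1^{\alpha_1}\cdots u_d^{\alpha_d}$, $\lambda^\beta=\lambda_1^{\beta_1}\cdots\lambda_n^{\beta_n}$. The coefficients $A_{k,\alpha}(\lambda)$ are polynomials in $\lambda$ of degrees $d_{k,\alpha}$. For a series $f_\lambda(z)=\sum_{k=0}^\infty a_k(\lambda)z^k$ whose coefficients $a_k(\lambda)$ are polynomials in $\lambda$, the Bautin ideal $I$ of $f$ is the ideal of the polynomial ring $\mathbb{C}[\lambda]$ generated by all the Taylor coefficients $a_0(\lambda),a_1(\lambda),\dots,a_k(\lambda),\dots$.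
   Formalization: The polynomials P_k are assumed to have no free term (A_{k,0}(λ)=0, so the sum runs over 1≤|α|≤d_k); with α=0 allowed the claim fails, e.g. d=1, a_0=0, P_k=1 gives I=C[λ] while (a_0)=0. *)

(* Defs.v *)
From mathcomp Require Import all_boot all_order all_algebra.
From mathcomp Require Import boolp classical_sets reals.
From mathcomp Require Import complex mpoly.

Set Implicit Arguments.
Unset Strict Implicit.
Unset Printing Implicit Defensive.

Import GRing.Theory.
Local Open Scope ring_scope.
Local Open Scope classical_set_scope.

(* [ring_quotient.idealr] is not used here: it only covers proper ideals with
   a boolean membership predicate, and a Bautin ideal may be the whole ring. *)
Definition is_ideal (A : comNzRingType) (I : set A) : Prop :=
  [/\ I 0,
      forall x y, I x -> I y -> I (x + y)
    & forall r x, I x -> I (r * x)].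

Definition ideal_generated (A : comNzRingType) (S : set A) : set A :=
  smallest (@is_ideal A) S.

(* The formal series \sum_k a_k z^k over A is given by its coefficients a. *)
Definition bautin_ideal (A : comNzRingType) (a : nat -> A) : set A :=
  ideal_generated (range a).

(* The polynomials P_k, k >= d, are in u_1, ..., u_d with coefficients in A.
   The variable u_(i+1) is indexed by i : 'I_d, hence receives a_(k-(i+1));
   the value of P k for k < d is irrelevant. *)
Definition polynomial_recurrence (A : comNzRingType) (d : nat)
    (P : nat -> {mpoly A[d]}) (a : nat -> A) : Prop :=
  forall k, (d <= k)%N -> a k = (P k).@[fun i : 'I_d => a (k - i.+1)%N].

(* Main.v *)
Require Import Defs.
From mathcomp Require Import all_boot all_order all_algebra.
From mathcomp Require Import boolp classical_sets reals.
From mathcomp Require Import complex mpoly.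

Local Open Scope ring_scope.
Local Open Scope classical_set_scope.

(** A polynomial without free term takes its values in every ideal that
    contains its arguments, because each of its monomials has an argument as a
    factor ([ideal_meval]). Hence, in the recurrence, [a k] lies in every ideal
    that contains the [d] terms before it, and by strong induction on [k] all
    terms lie in the ideal generated by the first [d] ([recurrence_in_ideal]). *)

Import GRing.Theory.

Lemma is_ideal_generated (A : comNzRingType) (S : set A) :
  is_ideal (ideal_generated S).
Proof.
split=> [J [[J0 _ _] _] //|x y Ix Iy J JS|r x Ix J JS].
- by case: (JS) => -[_ JD _] _; apply: JD; [exact: Ix | exact: Iy].
- by case: (JS) => -[_ _ JM] _; apply: JM; exact: Ix.
Qed.

Lemma ideal_meval (A : comNzRingType) (d : nat) (I : set A)
    (p : {mpoly A[d]}) (v : 'I_d -> A) :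
  is_ideal I -> p@_0%MM = 0 -> (forall i, I (v i)) -> I p.@[v].
Proof.
move=> [I0 ID IM] p0 Iv; rewrite mevalE big_seq.
apply: big_ind => // m supp_m; apply: (IM).
have m_neq0 : m != 0%MM.
  by apply: contraL supp_m => /eqP ->; rewrite mcoeff_msupp p0 eqxx.
have [i mi_neq0] : exists i, m i != 0%N.
  apply/existsP; apply: contra_neqT m_neq0 => /existsPn m0.
  by apply/mnmP => i; rewrite mnm0E; apply/eqP; move: (m0 i); rewrite negbK.
by rewrite (bigD1 i) //= -(prednK (n := m i)) ?lt0n // exprSr mulrAC; apply: IM.
Qed.

(** Strong induction on [k]: for [d <= k] the arguments of [P k] are strictly
    earlier terms. If [d = 0] there are no arguments and [P k] is zero, so the
    claim reads [I 0]. *)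
Lemma recurrence_in_ideal (A : comNzRingType) (d : nat)
    (P : nat -> {mpoly A[d]}) (a : nat -> A) (I : set A) :
    (forall k, (d <= k)%N -> (P k)@_0%MM = 0) -> polynomial_recurrence P a ->
    is_ideal I -> (forall k, (k < d)%N -> I (a k)) ->
  forall k, I (a k).
Proof.
move=> P0 aP idI Iinit; elim/ltn_ind => k IH.
have [dk | kd] := leqP d k; last exact: Iinit.
rewrite aP //; apply: ideal_meval => // [|i]; first exact: P0.
by apply: IH; rewrite ltn_subrL /= (leq_trans _ dk) // (leq_ltn_trans _ (ltn_ord i)).
Qed.

(* [hP0] says that the P_k have no free term in u: with the term alpha = 0
   allowed the claim fails (d = 1, a_0 = 0, P_k = 1). *)
Theorem theorem4p2 (R : realType) (n d : nat)
    (a : nat -> {mpoly R[i][n]}) (P : nat -> {mpoly {mpoly R[i][n]}[d]})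
    (hP0 : forall k, (d <= k)%N -> (P k)@_0%MM = 0)
    (ha : polynomial_recurrence P a) :
  bautin_ideal a = ideal_generated (a @` [set k | (k < d)%N]).
Proof.
apply/seteqP; split.
- apply: smallest_sub; first exact: is_ideal_generated.
  move=> _ [k _ <-]; apply: (recurrence_in_ideal _ _ _ _ _ hP0 ha).
    exact: is_ideal_generated.
  by move=> j jd; apply: sub_gen_smallest; exists j.
- apply: sub_smallest2r; first exact: is_ideal_generated.
  by move=> _ [k _ <-]; exists k.
Qed.
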